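(* Let $\mathcal C$ be a GV-category, $\mathcal M$ a left GV-module category over $\mathcal C$, and let $m\in\widehat{\mathcal M}^{\otimes}$ be such that the object $S(m)$ is isomorphic to $m$. Then for every choice of isomorphism $p\colon m\to S(m)$ in $\mathcal M$, the algebra $(\underline{\mathrm{Hom}}(m,m),\mu)$, with $\mu$ the internal composition, is a GV-Frobenius algebra in $\mathcal C$ with Frobenius form $$\lambda\colon\underline{\mathrm{Hom}}(m,m)\xrightarrow{\ \underline{\mathrm{Hom}}(m,p)\ }\underline{\mathrm{Hom}}(m,S(m))\xrightarrow{\ \mathrm{tr}_m\ }K.$$
   Context: A GV-category is a monoidal category $(\mathcal C,\otimes,1)$ with a chosen dualizing object $K$: for every $y$ the functor $x\mapsto\mathrm{Hom}(x\otimes y,K)$ is represented by an object $Gy$, and the resulting contravariant functor $G$ is an anti-equivalence; $G(1)=K$ canonically. The second tensor product is $x\odot y:=G^{-1}(Gy\otimes Gx)$, with unit $K$. $c\odot{-}$ is right adjoint to $Gc\otimes{-}$, with counit $\mathrm{ev}_{c,y}\colon Gc\otimes(c\odot y)\to y$ and unit $\mathrm{coev}_{c,y}\colon y\to c\odot(Gc\otimes y)$; $\mathrm{coev}^{\mathrm r}_c:=\mathrm{coev}_{c,1}\colon1\to c\odot Gc$. The distributor $\delta^{\mathrm r}_{x,y,z}\colon(x\odot y)\otimes z\to x\odot(y\otimes z)$ is the adjunct of $\mathrm{ev}_{x,y}\otimes\mathrm{id}_z\colon Gx\otimes(x\odot y)\otimes z\to y\otimes z$; the distributor $\delta^{\mathrm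 l}_{x,y,z}\colon x\otimes(y\odot z)\to(x\otimes y)\odot z$ is the adjunct of $\mathrm{coev}_{G^{-1}x,y}\odot\mathrm{id}_z\colon y\odot z\to G^{-1}x\odot(x\otimes y)\odot z$. A left GV-module category is a left module category $(\mathcal M,\triangleright)$ over $(\mathcal C,\otimes)$ such that all functors $c\triangleright{-}$ and ${-}\triangleright m$ have right adjoints. Let $c\blacktriangleright{-}$ be a fixed right adjoint of $Gc\triangleright{-}$; $\blacktriangleright$ is an action of $(\mathcal C,\odot)$. Internal Hom and coHom: $\mathrm{Hom}_{\mathcal M}(c\triangleright m,n)\cong\mathrm{Hom}_{\mathcal C}(c,\underline{\mathrm{Hom}}(m,n))$ and $\mathrm{Hom}_{\mathcal M}(n,c\blacktriangleright m)\cong\mathrm{Hom}_{\mathcal C}(\underline{\mathrm{coHom}}(m,n),c)$; $\underline{\mathrm{coHom}}(m,n)\cong G^{-1}\underline{\mathrm{Hom}}(n,m)$ canonically. $\underline{\mathrm{Hom}}(m,m)$ is an algebra in $(\mathcal C,\otimes,1)$ via the internal composition $\mu$ and the unit $u_m\colon1\to\underline{\mathrm{Hom}}(m,m)$ adjunct to $1\triangleright m\cong m$. $Y_m:=\underline{\mathrm{Hom}}(m,-)$ is a lax $\triangleright$-module functor, with $c\otimes\underline{\mathrm{Hom}}(m,n)\to\underline{\mathrm{Hom}}(m,c\triangleright n)$ adjunct to the action of $c$ on the evaluation. $\widehat{\mathcal M}^{\otimes}$ is the full subcategory of objects $m$ for which $Y_m$ is a strong $\triangleright$-module functor and has a right adjoint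 $Y_m^{\mathrm{r.a.}}$ (which is then a strong $\blacktriangleright$-module functor). Relative Serre functor: $S(m):=Y_m^{\mathrm{r.a.}}(K)$ for $m\in\widehat{\mathcal M}^{\otimes}$. The isomorphisms $\mathrm{Hom}(\underline{\mathrm{Hom}}(m,n),c)\cong\mathrm{Hom}(n,Y_m^{\mathrm{r.a.}}(c))\cong\mathrm{Hom}(n,c\blacktriangleright S(m))\cong\mathrm{Hom}(\underline{\mathrm{coHom}}(S(m),n),c)$ yield an isomorphism $\phi_m\colon\underline{\mathrm{Hom}}(m,-)\cong\underline{\mathrm{coHom}}(S(m),-)$ and hence natural isomorphisms $\widetilde\phi_m(n)\colon\underline{\mathrm{Hom}}(n,S(m))\cong G(\underline{\mathrm{Hom}}(m,n))$. The trace is $\mathrm{tr}_m\colon\underline{\mathrm{Hom}}(m,S(m))\xrightarrow{\widetilde\phi_m(m)}G(\underline{\mathrm{Hom}}(m,m))\xrightarrow{G(u_m)}G(1)=K$. A GV-Frobenius algebra is $(A,\mu,\eta,\Delta,\varepsilon)$ with $(A,\mu,\eta)$ an algebra in $(\mathcal C,\otimes,1)$, $(A,\Delta,\varepsilon)$ a coalgebra in $(\mathcal C,\odot,K)$ and $(\mu\odot\mathrm{id})\circ\delta^{\mathrm l}_{A,A,A}\circ(\mathrm{id}\otimes\Delta)=\Delta\circ\mu=(\mathrm{id}\odot\mu)\circ\delta^{\mathrm r}_{A,A,A}\circ(\Delta\otimes\mathrm{id})$. A Frobenius form on an algebra $A$ is a morphism $\lambda\colon A\to K$ such that $A\cong A\otimes1\xrightarrow{\mathrm{id}\otimes\mathrm{coev}^{\mathrm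 r}_A}A\otimes(A\odot GA)\xrightarrow{\delta^{\mathrm l}_{A,A,GA}}(A\otimes A)\odot GA\xrightarrow{(\lambda\circ\mu)\odot\mathrm{id}}K\odot GA\cong GA$ is invertible; giving a Frobenius form on an algebra is equivalent to giving a GV-Frobenius algebra structure on it, via the invariant non-degenerate pairing $\lambda\circ\mu=\varepsilon\circ\mu$ (so $\varepsilon=\lambda$). *)

(* Defs.v *)
From mathcomp Require Import ssreflect ssrfun ssrbool.

Set Implicit Arguments.
Unset Strict Implicit.
Unset Printing Implicit Defensive.

Declare Scope cat_scope.
Delimit Scope cat_scope with cat.
Local Open Scope cat_scope.

Reserved Notation "g ∘ f" (at level 40, left associativity).
Reserved Notation "x ⊗ y" (at level 34, no associativity).
Reserved Notation "f ⊗₁ g" (at level 34, no associativity).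
Reserved Notation "x ⊙ y" (at level 34, no associativity).
Reserved Notation "f ⊙₁ g" (at level 34, no associativity).
Reserved Notation "c ▷ m" (at level 34, no associativity).
Reserved Notation "f ▷₁ g" (at level 34, no associativity).
Reserved Notation "c ▶ m" (at level 34, no associativity).

Record category := Category {
  ob :> Type;
  hom : ob -> ob -> Type;
  idm : forall x, hom x x;
  comp : forall x y z, hom y z -> hom x y -> hom x z;
  comp1m : forall x y (f : hom x y), comp (idm y) f = f;
  compm1 : forall x y (f : hom x y), comp f (idm x) = f;
  compmA : forall x y z t (h : hom z t) (g : hom y z) (f : hom x y),
    comp h (comp g f) = comp (comp h g) f
}.
Arguments hom {c} x y.
Arguments idm {c} x.
Arguments comp {c x y z} g f.
Notation "g ∘ f" := (comp g f) : cat_scope.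

Definition op (C : category) : category :=
  @Category C (fun x y => @hom C y x) (fun x => idm x)
    (fun x y z g f => f ∘ g)
    (fun x y f => compm1 f) (fun x y f => comp1m f)
    (fun x y z t h g f => esym (compmA f g h)).

Section Iso.
Variable C : category.

Definition is_iso (x y : C) (f : hom x y) : Prop :=
  exists g : hom y x, g ∘ f = idm x /\ f ∘ g = idm y.

Record iso (x y : C) := Iso {
  iso_hom :> hom x y;
  inv : hom y x;
  inv_iso : inv ∘ iso_hom = idm x;
  iso_inv : iso_hom ∘ inv = idm y
}.
End Iso.

Record functor (A B : category) := Functor {
  fob :> A -> B;
  fmap : forall x y, hom x y -> hom (fob x) (fob y);
  fmap1 : forall x, fmap (idm x) = idm (fob x);
  fmapM : forall x y z (g : hom y z) (f : hom x y),
    fmap (g ∘ f) = fmap g ∘ fmap f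
}.
Arguments fmap {A B} F {x y} f : rename.

(* A chosen quasi-inverse of F, with unit and counit normalised so that they
   form an adjoint equivalence (the other triangle identity follows). *)
Record quasi_inverse (A B : category) (F : functor A B) := QuasiInverse {
  qinv :> functor B A;
  qunit : forall x : A, iso x (qinv (F x));
  qunit_nat : forall (x y : A) (f : hom x y),
    fmap qinv (fmap F f) ∘ qunit x = qunit y ∘ f;
  qcounit : forall y : B, iso (F (qinv y)) y;
  qcounit_nat : forall (x y : B) (f : hom x y),
    f ∘ qcounit x = qcounit y ∘ fmap F (fmap qinv f);
  qtriangle : forall x : A, qcounit (F x) ∘ fmap F (qunit x) = idm (F x)
}.

Section QuasiInverse.
Variables (A B : category) (F : functor A B) (Q : quasi_inverse F).

Lemma qinv_faithful (x y : A) (f g : hom x y) : fmap F f = fmap F g -> f = g.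
Proof.
move=> e; rewrite -[f]comp1m -[g]comp1m -(inv_iso (qunit Q y)) -!compmA.
by rewrite -!qunit_nat e.
Qed.

Lemma qtriangle2 (w : B) : fmap Q (qcounit Q w) ∘ qunit Q (Q w) = idm (Q w).
Proof.
apply: qinv_faithful; rewrite fmapM fmap1 -(qtriangle Q).
congr (_ ∘ _).
by rewrite -[LHS]comp1m -[RHS]comp1m -(inv_iso (qcounit Q w)) -!compmA qcounit_nat.
Qed.
End QuasiInverse.

(* The right adjoint is given by representing objects of the functors
   Hom (F -, y); its action on morphisms is then forced, see ra_functor. *)
Record right_adjoint (A B : category) (F : functor A B) := RightAdjoint {
  ra_ob :> B -> A;
  adj : forall x y, hom (F x) y -> hom x (ra_ob y);
  unadj : forall x y, hom x (ra_ob y) -> hom (F x) y;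
  adjK : forall x y (f : hom (F x) y), unadj (adj f) = f;
  unadjK : forall x y (f : hom x (ra_ob y)), adj (unadj f) = f;
  adj_nat : forall x x' y (f : hom (F x) y) (g : hom x' x),
    adj (f ∘ fmap F g) = adj f ∘ g
}.
Arguments adj {A B F} r {x y} f.
Arguments unadj {A B F} r {x y} f.

Section RightAdjoint.
Variables (A B : category) (F : functor A B) (R : right_adjoint F).

Definition ra_counit (y : B) : hom (F (R y)) y := unadj R (idm (R y)).
Definition ra_unit (x : A) : hom x (R (F x)) := adj R (idm (F x)).

Definition ra_map (y y' : B) (f : hom y y') : hom (R y) (R y') :=
  adj R (f ∘ ra_counit y).

Lemma unadj_nat x x' y (f : hom x (R y)) (g : hom x' x) :
  unadj R (f ∘ g) = unadj R f ∘ fmap F g.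
Proof. by rewrite -{1}[f](unadjK (r := R)) -adj_nat adjK. Qed.

Lemma unadjE x y (f : hom x (R y)) : unadj R f = ra_counit y ∘ fmap F f.
Proof. by rewrite /ra_counit -unadj_nat comp1m. Qed.

Lemma ra_map1 y : ra_map (idm y) = idm (R y).
Proof. by rewrite /ra_map comp1m unadjK. Qed.

Lemma ra_mapM x y z (g : hom y z) (f : hom x y) :
  ra_map (g ∘ f) = ra_map g ∘ ra_map f.
Proof. by rewrite /ra_map -adj_nat -!compmA -unadjE adjK. Qed.

Definition ra_functor : functor B A := Functor ra_map1 ra_mapM.
End RightAdjoint.

Record monoidal := Monoidal {
  mon_cat :> category;
  tens : mon_cat -> mon_cat -> mon_cat;
  one : mon_cat;
  tensm : forall x y x' y',
    hom x x' -> hom y y' -> hom (tens x y) (tens x' y');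
  tensm1 : forall x y, tensm (idm x) (idm y) = idm (tens x y);
  tensmM : forall x y x' y' x'' y'' (f' : hom x' x'') (g' : hom y' y'')
      (f : hom x x') (g : hom y y'),
    tensm (f' ∘ f) (g' ∘ g) = tensm f' g' ∘ tensm f g;
  assoc : forall x y z, iso (tens (tens x y) z) (tens x (tens y z));
  assoc_nat : forall x y z x' y' z' (f : hom x x') (g : hom y y') (h : hom z z'),
    assoc x' y' z' ∘ tensm (tensm f g) h = tensm f (tensm g h) ∘ assoc x y z;
  lunit : forall x, iso (tens one x) x;
  lunit_nat : forall x y (f : hom x y),
    lunit y ∘ tensm (idm one) f = f ∘ lunit x;
  runit : forall x, iso (tens x one) x;
  runit_nat : forall x y (f : hom x y),
    runit y ∘ tensm f (idm one) = f ∘ runit x;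
  pentagon : forall x y z t,
    assoc x y (tens z t) ∘ assoc (tens x y) z t =
    tensm (idm x) (assoc y z t) ∘ assoc x (tens y z) t
      ∘ tensm (assoc x y z) (idm t);
  triangle : forall x y,
    tensm (idm x) (lunit y) ∘ assoc x one y = tensm (runit x) (idm y)
}.
Arguments tens {m} x y.
Arguments one {m}.
Arguments tensm {m x y x' y'} f g.
Arguments assoc {m} x y z.
Arguments lunit {m} x.
Arguments runit {m} x.
Notation "x ⊗ y" := (tens x y) : cat_scope.
Notation "f ⊗₁ g" := (tensm f g) : cat_scope.

Section TensorFunctor.
Variable C : monoidal.

Lemma tensm_lr (x x' y y' : C) (f : hom x x') (g : hom y y') :
  (f ⊗₁ idm y') ∘ (idm x ⊗₁ g) = f ⊗₁ g.
Proof. by rewrite -tensmM comp1m compm1. Qed.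

Lemma tensm_rl (x x' y y' : C) (f : hom x x') (g : hom y y') :
  (idm x' ⊗₁ g) ∘ (f ⊗₁ idm y) = f ⊗₁ g.
Proof. by rewrite -tensmM comp1m compm1. Qed.

Lemma tens_by_mapM (c x y z : C) (g : hom y z) (f : hom x y) :
  idm c ⊗₁ (g ∘ f) = (idm c ⊗₁ g) ∘ (idm c ⊗₁ f).
Proof. by rewrite -tensmM comp1m. Qed.

Definition tens_by (c : C) : functor C C :=
  @Functor C C (fun x => c ⊗ x) (fun x y f => idm c ⊗₁ f)
    (tensm1 c) (@tens_by_mapM c).
End TensorFunctor.

(* An object K together with objects G y representing Hom (- ⊗ y, K). *)
Record predual (C : monoidal) := Predual {
  pdK : C;
  pdG : C -> C;
  pd_adj : forall x y, hom (x ⊗ y) pdK -> hom x (pdG y);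
  pd_unadj : forall x y, hom x (pdG y) -> hom (x ⊗ y) pdK;
  pd_adjK : forall x y (f : hom (x ⊗ y) pdK), pd_unadj (pd_adj f) = f;
  pd_unadjK : forall x y (f : hom x (pdG y)), pd_adj (pd_unadj f) = f;
  pd_adj_nat : forall x x' y (f : hom (x ⊗ y) pdK) (g : hom x' x),
    pd_adj (f ∘ (g ⊗₁ idm y)) = pd_adj f ∘ g
}.

Section Predual.
Variables (C : monoidal) (D : predual C).

Definition pd_pairing (y : C) : hom (pdG D y ⊗ y) (pdK D) :=
  pd_unadj (idm (pdG D y)).

Definition pd_Gmap (y y' : C) (f : hom y y') : hom (pdG D y') (pdG D y) :=
  pd_adj (pd_pairing y' ∘ (idm (pdG D y') ⊗₁ f)).

Lemma pd_unadj_nat x x' y (f : hom x (pdG D y)) (g : hom x' x) :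
  pd_unadj (f ∘ g) = pd_unadj f ∘ (g ⊗₁ idm y).
Proof. by rewrite -{1}[f]pd_unadjK -pd_adj_nat pd_adjK. Qed.

Lemma pd_unadjE x y (f : hom x (pdG D y)) :
  pd_unadj f = pd_pairing y ∘ (f ⊗₁ idm y).
Proof. by rewrite /pd_pairing -pd_unadj_nat comp1m. Qed.

Lemma pd_pairing_nat (y y' : C) (f : hom y y') :
  pd_pairing y ∘ (pd_Gmap f ⊗₁ idm y) = pd_pairing y' ∘ (idm _ ⊗₁ f).
Proof. by rewrite -pd_unadjE pd_adjK. Qed.

Lemma pd_Gmap1 (y : C) : pd_Gmap (idm y) = idm (pdG D y).
Proof. by rewrite /pd_Gmap tensm1 compm1 pd_unadjK. Qed.

Lemma pd_GmapM (x y z : C) (g : hom y z) (f : hom x y) :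
  pd_Gmap (g ∘ f) = pd_Gmap f ∘ pd_Gmap g.
Proof.
rewrite {1}/pd_Gmap tens_by_mapM compmA -pd_pairing_nat -compmA tensm_lr.
by rewrite -tensm_rl compmA pd_adj_nat.
Qed.

Definition pd_functor : functor (op C) C :=
  @Functor (op C) C (pdG D) (fun x y f => pd_Gmap f)
    pd_Gmap1 (fun x y z g f => pd_GmapM f g).
End Predual.

Record gv_category := GVCategory {
  gv_mon :> monoidal;
  gv_dual : predual gv_mon;
  gv_equiv : quasi_inverse (pd_functor gv_dual)
}.

Section GVCategory.
Variable C : gv_category.

Definition gvK : C := pdK (gv_dual C).
Definition gvG (y : C) : C := pdG (gv_dual C) y.
Definition gvGm (y y' : C) (f : hom y y') : hom (gvG y') (gvG y) := pd_Gmap _ f.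

Definition gvGi (w : C) : C := gv_equiv C w.
Definition gvGim (w w' : C) (f : hom w w') : hom (gvGi w') (gvGi w) :=
  fmap (gv_equiv C) f.

(* In op C the unit of the equivalence points from G^-1 (G y) to y. *)
Definition gvGiG (y : C) : hom (gvGi (gvG y)) y := qunit (gv_equiv C) y.
Definition gvGiG_inv (y : C) : hom y (gvGi (gvG y)) := inv (qunit (gv_equiv C) y).
Definition gvGGi (w : C) : hom (gvG (gvGi w)) w := qcounit (gv_equiv C) w.
Definition gvGGi_inv (w : C) : hom w (gvG (gvGi w)) := inv (qcounit (gv_equiv C) w).

Definition gv_curry (x y : C) (f : hom (x ⊗ y) gvK) : hom x (gvG y) :=
  pd_adj f.
Definition gv_uncurry (x y : C) (f : hom x (gvG y)) : hom (x ⊗ y) gvK :=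
  pd_unadj f.
Definition gv_pairing (y : C) : hom (gvG y ⊗ y) gvK := gv_uncurry (idm (gvG y)).

(* Hom (x ⊗ y, K) = Hom (x, G y) = Hom (y, G^-1 x) *)
Definition gv_cocurry (x y : C) (f : hom (x ⊗ y) gvK) : hom y (gvGi x) :=
  gvGim (gv_curry f) ∘ gvGiG_inv y.
Definition gv_councurry (x y : C) (f : hom y (gvGi x)) : hom (x ⊗ y) gvK :=
  gv_uncurry (gvGm f ∘ gvGGi_inv x).

(* The canonical isomorphism G 1 = K: both represent Hom (-, K). *)
Definition G1_to_K : hom (gvG one) gvK := gv_pairing one ∘ inv (runit (gvG one)).

(* Invertible, as G is an anti-equivalence; it is what turns the unitors of ⊗
   into those of ⊙ below. *)
Definition one_to_GK : hom one (gvG gvK) := gv_curry (lunit gvK).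

Definition odot (x y : C) : C := gvGi (gvG y ⊗ gvG x).
Definition odotm (x y x' y' : C) (f : hom x x') (g : hom y y') :
    hom (odot x y) (odot x' y') :=
  gvGim (gvGm g ⊗₁ gvGm f).
Local Notation "x ⊙ y" := (odot x y) : cat_scope.
Local Notation "f ⊙₁ g" := (odotm f g) : cat_scope.

Definition odot_assoc (x y z : C) : hom ((x ⊙ y) ⊙ z) (x ⊙ (y ⊙ z)) :=
  gvGim ((idm (gvG z) ⊗₁ gvGGi_inv (gvG y ⊗ gvG x))
           ∘ assoc (gvG z) (gvG y) (gvG x)
           ∘ (gvGGi (gvG z ⊗ gvG y) ⊗₁ idm (gvG x))).

Definition odot_lunit (x : C) : hom (gvK ⊙ x) x :=
  gvGiG x ∘ gvGim ((idm (gvG x) ⊗₁ one_to_GK) ∘ inv (runit (gvG x))).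

Definition odot_runit (x : C) : hom (x ⊙ gvK) x :=
  gvGiG x ∘ gvGim ((one_to_GK ⊗₁ idm (gvG x)) ∘ inv (lunit (gvG x))).

(* Hom (Gc ⊗ x, y) = Hom (Gy ⊗ (Gc ⊗ x), K) = Hom ((Gy ⊗ Gc) ⊗ x, K)
   = Hom (x, G^-1 (Gy ⊗ Gc)) *)
Definition odot_adj (c x y : C) (f : hom (gvG c ⊗ x) y) : hom x (c ⊙ y) :=
  gv_cocurry (gv_pairing y ∘ (idm (gvG y) ⊗₁ f) ∘ assoc (gvG y) (gvG c) x).
Definition odot_unadj (c x y : C) (f : hom x (c ⊙ y)) : hom (gvG c ⊗ x) y :=
  gvGiG y ∘ gv_cocurry (gv_councurry f ∘ inv (assoc (gvG y) (gvG c) x)).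

Lemma gvGiGK (y : C) : gvGiG_inv y ∘ gvGiG y = idm _.
Proof. exact: (iso_inv (qunit (gv_equiv C) y)). Qed.

Lemma gvGiG_invK (y : C) : gvGiG y ∘ gvGiG_inv y = idm y.
Proof. exact: (inv_iso (qunit (gv_equiv C) y)). Qed.

Lemma gvGGiK (w : C) : gvGGi_inv w ∘ gvGGi w = idm _.
Proof. exact: inv_iso. Qed.

Lemma gvGGi_invK (w : C) : gvGGi w ∘ gvGGi_inv w = idm w.
Proof. exact: iso_inv. Qed.

Lemma gvGmM (x y z : C) (g : hom y z) (f : hom x y) :
  gvGm (g ∘ f) = gvGm f ∘ gvGm g.
Proof. exact: pd_GmapM. Qed.

Lemma gvGm1 (x : C) : gvGm (idm x) = idm _.
Proof. exact: pd_Gmap1. Qed.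

Lemma gvGimM (x y z : C) (g : hom y z) (f : hom x y) :
  gvGim (g ∘ f) = gvGim f ∘ gvGim g.
Proof. exact: (fmapM (gv_equiv C)). Qed.

Lemma gvGim1 (x : C) : gvGim (idm x) = idm _.
Proof. exact: (fmap1 (gv_equiv C)). Qed.

Lemma gvGiG_nat (x y : C) (f : hom x y) :
  gvGiG y ∘ gvGim (gvGm f) = f ∘ gvGiG x.
Proof. exact: (qunit_nat (gv_equiv C) (f : @hom (op C) y x)). Qed.

Lemma gvGiG_inv_nat (x y : C) (f : hom x y) :
  gvGim (gvGm f) ∘ gvGiG_inv x = gvGiG_inv y ∘ f.
Proof.
rewrite -[LHS]comp1m -gvGiGK -compmA (compmA (gvGiG y)) gvGiG_nat.
by rewrite -(compmA f) gvGiG_invK compm1.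
Qed.

Lemma gvGGi_nat (w w' : C) (f : hom w w') :
  f ∘ gvGGi w = gvGGi w' ∘ gvGm (gvGim f).
Proof. exact: (qcounit_nat (gv_equiv C) f). Qed.

Lemma gvGGi_inv_nat (w w' : C) (f : hom w w') :
  gvGGi_inv w' ∘ f = gvGm (gvGim f) ∘ gvGGi_inv w.
Proof.
rewrite -[LHS]compm1 -(gvGGi_invK w) compmA -(compmA _ f) gvGGi_nat.
by rewrite (compmA (gvGGi_inv w')) gvGGiK comp1m.
Qed.

Lemma gvG_triangle' (y : C) : gvGGi (gvG y) ∘ gvGm (gvGiG y) = idm _.
Proof. exact: (qtriangle (gv_equiv C) (y : op C)). Qed.

Lemma gvGi_triangle' (w : C) : gvGiG (gvGi w) ∘ gvGim (gvGGi w) = idm _.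
Proof. exact: (qtriangle2 (gv_equiv C) w). Qed.

Lemma gvG_triangle (y : C) : gvGm (gvGiG_inv y) ∘ gvGGi_inv (gvG y) = idm _.
Proof.
rewrite -[gvGGi_inv _]compm1 -gvG_triangle' (compmA (gvGGi_inv _)) gvGGiK comp1m.
by rewrite -gvGmM gvGiG_invK gvGm1 gvG_triangle'.
Qed.

Lemma gvGi_triangle (w : C) : gvGim (gvGGi_inv w) ∘ gvGiG_inv (gvGi w) = idm _.
Proof.
rewrite -[gvGiG_inv _]compm1 -gvGi_triangle' (compmA (gvGiG_inv _)) gvGiGK comp1m.
by rewrite -gvGimM gvGGi_invK gvGim1 gvGi_triangle'.
Qed.

Lemma gv_curry_natr (x y y' : C) (f : hom (x ⊗ y) gvK) (g : hom y' y) :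
  gv_curry (f ∘ (idm x ⊗₁ g)) = gvGm g ∘ gv_curry f.
Proof.
rewrite -[f in LHS](pd_adjK (p := gv_dual C)) pd_unadjE -compmA tensm_lr.
rewrite -tensm_rl compmA -pd_pairing_nat -pd_unadjE.
by rewrite -pd_unadj_nat /gv_curry pd_unadjK.
Qed.

Lemma gv_cocurry_nat (x y y' : C) (f : hom (x ⊗ y) gvK) (g : hom y' y) :
  gv_cocurry (f ∘ (idm x ⊗₁ g)) = gv_cocurry f ∘ g.
Proof.
by rewrite /gv_cocurry gv_curry_natr gvGimM -!compmA gvGiG_inv_nat.
Qed.

Lemma gv_cocurryK (x y : C) (f : hom (x ⊗ y) gvK) :
  gv_councurry (gv_cocurry f) = f.
Proof.
rewrite /gv_councurry /gv_cocurry gvGmM -compmA -gvGGi_inv_nat compmA.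
by rewrite gvG_triangle comp1m /gv_uncurry /gv_curry pd_adjK.
Qed.

Lemma gv_councurryK (x y : C) (f : hom y (gvGi x)) :
  gv_cocurry (gv_councurry f) = f.
Proof.
rewrite /gv_councurry /gv_cocurry /gv_curry /gv_uncurry pd_unadjK gvGimM.
by rewrite -compmA gvGiG_inv_nat compmA gvGi_triangle comp1m.
Qed.

Lemma gv_cocurry_pairing (y : C) : gv_cocurry (gv_pairing y) = gvGiG_inv y.
Proof.
by rewrite /gv_cocurry /gv_curry /gv_pairing /gv_uncurry pd_unadjK gvGim1 comp1m.
Qed.

Lemma odot_adjK (c x y : C) (f : hom (gvG c ⊗ x) y) :
  odot_unadj (odot_adj f) = f.
Proof.
rewrite /odot_unadj /odot_adj gv_cocurryK -(compmA _ (assoc _ _ _)) iso_inv compm1.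
by rewrite gv_cocurry_nat gv_cocurry_pairing compmA gvGiG_invK comp1m.
Qed.

Lemma odot_unadjK (c x y : C) (f : hom x (c ⊙ y)) :
  odot_adj (odot_unadj f) = f.
Proof.
rewrite /odot_adj /odot_unadj.
rewrite -[gv_pairing y ∘ _]gv_cocurryK gv_cocurry_nat gv_cocurry_pairing.
rewrite compmA gvGiGK comp1m gv_cocurryK -compmA inv_iso compm1.
exact: gv_councurryK.
Qed.

Lemma odot_adj_nat (c x x' y : C) (f : hom (gvG c ⊗ x) y) (g : hom x' x) :
  odot_adj (f ∘ (idm (gvG c) ⊗₁ g)) = odot_adj f ∘ g.
Proof.
rewrite /odot_adj -gv_cocurry_nat tens_by_mapM -!compmA; congr (gv_cocurry (_ ∘ (_ ∘ _))).
by rewrite -assoc_nat tensm1.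
Qed.

Definition odot_ra (c : C) : right_adjoint (tens_by (gvG c)) :=
  @RightAdjoint C C (tens_by (gvG c)) (odot c) (@odot_adj c) (@odot_unadj c)
    (@odot_adjK c) (@odot_unadjK c) (@odot_adj_nat c).

Definition ev (c y : C) : hom (gvG c ⊗ (c ⊙ y)) y := ra_counit (odot_ra c) y.
Definition coev (c y : C) : hom y (c ⊙ (gvG c ⊗ y)) := ra_unit (odot_ra c) y.
(* composed with the unitor G c ⊗ 1 = G c *)
Definition coevr (c : C) : hom one (c ⊙ gvG c) :=
  (idm c ⊙₁ runit (gvG c)) ∘ coev c one.

Definition distr_r (x y z : C) : hom ((x ⊙ y) ⊗ z) (x ⊙ (y ⊗ z)) :=
  adj (odot_ra x)
    ((ev x y ⊗₁ idm z) ∘ inv (assoc (gvG x) (x ⊙ y) z)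
       : hom (tens_by (gvG x) _) _).

(* the adjunction is that between G (G^-1 x) ⊗ - = x ⊗ - and G^-1 x ⊙ - *)
Definition distr_l (x y z : C) : hom (x ⊗ (y ⊙ z)) ((x ⊗ y) ⊙ z) :=
  unadj (odot_ra (gvGi x))
    (odot_assoc (gvGi x) (x ⊗ y) z
       ∘ (((idm (gvGi x) ⊙₁ (gvGGi x ⊗₁ idm y)) ∘ coev (gvGi x) y) ⊙₁ idm z))
  ∘ (gvGGi_inv x ⊗₁ idm (y ⊙ z)).

Definition is_algebra (A : C) (mu : hom (A ⊗ A) A) (eta : hom one A) : Prop :=
  [/\ mu ∘ (mu ⊗₁ idm A) = mu ∘ (idm A ⊗₁ mu) ∘ assoc A A A,
      mu ∘ (eta ⊗₁ idm A) = lunit A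
    & mu ∘ (idm A ⊗₁ eta) = runit A].

Definition is_coalgebra (A : C) (delta : hom A (A ⊙ A)) (eps : hom A gvK) : Prop :=
  [/\ odot_assoc A A A ∘ (delta ⊙₁ idm A) ∘ delta = (idm A ⊙₁ delta) ∘ delta,
      odot_lunit A ∘ (eps ⊙₁ idm A) ∘ delta = idm A
    & odot_runit A ∘ (idm A ⊙₁ eps) ∘ delta = idm A].

Definition is_gv_frobenius_algebra (A : C) (mu : hom (A ⊗ A) A) (eta : hom one A)
    (delta : hom A (A ⊙ A)) (eps : hom A gvK) : Prop :=
  [/\ is_algebra mu eta,
      is_coalgebra delta eps,
      (mu ⊙₁ idm A) ∘ distr_l A A A ∘ (idm A ⊗₁ delta) = delta ∘ mu
    & delta ∘ mu = (idm A ⊙₁ mu) ∘ distr_r A A A ∘ (delta ⊗₁ idm A)].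

Definition frobenius_map (A : C) (mu : hom (A ⊗ A) A) (lam : hom A gvK) :
    hom A (gvG A) :=
  odot_lunit (gvG A) ∘ ((lam ∘ mu) ⊙₁ idm (gvG A)) ∘ distr_l A A (gvG A)
    ∘ (idm A ⊗₁ coevr A) ∘ inv (runit A).

Definition is_frobenius_form (A : C) (mu : hom (A ⊗ A) A) (eta : hom one A)
    (lam : hom A gvK) : Prop :=
  is_algebra mu eta /\ is_iso (frobenius_map mu lam).
End GVCategory.

Arguments gvK {C}.
Arguments one_to_GK {C}.
Arguments G1_to_K {C}.
Notation "x ⊙ y" := (odot x y) : cat_scope.
Notation "f ⊙₁ g" := (odotm f g) : cat_scope.

Record module_category (C : monoidal) := ModuleCategory {
  mod_cat :> category;
  act : C -> mod_cat -> mod_cat;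
  actm : forall c c' m m', hom c c' -> hom m m' -> hom (act c m) (act c' m');
  actm1 : forall c m, actm (idm c) (idm m) = idm (act c m);
  actmM : forall c c' c'' m m' m'' (f' : hom c' c'') (g' : hom m' m'')
      (f : hom c c') (g : hom m m'),
    actm (f' ∘ f) (g' ∘ g) = actm f' g' ∘ actm f g;
  act_assoc : forall c d m, iso (act (c ⊗ d) m) (act c (act d m));
  act_assoc_nat : forall c d m c' d' m' (f : hom c c') (g : hom d d') (h : hom m m'),
    act_assoc c' d' m' ∘ actm (f ⊗₁ g) h = actm f (actm g h) ∘ act_assoc c d m;
  act_unit : forall m, iso (act one m) m;
  act_unit_nat : forall m m' (f : hom m m'),
    act_unit m' ∘ actm (idm one) f = f ∘ act_unit m;
  act_pentagon : forall b c d m,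
    act_assoc b c (act d m) ∘ act_assoc (b ⊗ c) d m =
    actm (idm b) (act_assoc c d m) ∘ act_assoc b (c ⊗ d) m
      ∘ actm (assoc b c d) (idm m);
  act_triangle : forall c m,
    actm (idm c) (act_unit m) ∘ act_assoc c one m = actm (runit c) (idm m)
}.
Arguments act {C m} c m0 : rename.
Arguments actm {C m c c' m0 m'} f g : rename.
Arguments act_assoc {C m} c d m0 : rename.
Arguments act_unit {C m} m0 : rename.
Notation "c ▷ m" := (act c m) : cat_scope.
Notation "f ▷₁ g" := (actm f g) : cat_scope.

Section ModuleFunctors.
Variables (C : monoidal) (M : module_category C).

Lemma act_by_mapM (c : C) (x y z : M) (g : hom y z) (f : hom x y) :
  idm c ▷₁ (g ∘ f) = (idm c ▷₁ g) ∘ (idm c ▷₁ f).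
Proof. by rewrite -actmM comp1m. Qed.

Lemma act_on_mapM (m : M) (x y z : C) (g : hom y z) (f : hom x y) :
  (g ∘ f) ▷₁ idm m = (g ▷₁ idm m) ∘ (f ▷₁ idm m).
Proof. by rewrite -actmM comp1m. Qed.

Definition act_by (c : C) : functor M M :=
  @Functor M M (fun m => c ▷ m) (fun x y f => idm c ▷₁ f)
    (fun m => actm1 c m) (@act_by_mapM c).

Definition act_on (m : M) : functor C M :=
  @Functor C M (fun c => c ▷ m) (fun x y f => f ▷₁ idm m)
    (fun c => actm1 c m) (@act_on_mapM m).
End ModuleFunctors.

(* The right adjoints are part of the data; they exist by hypothesis and are
   unique up to unique isomorphism. *)
Record gv_module (C : gv_category) := GVModule {
  gvm_mod :> module_category C;
  act_by_ra : forall c : C, right_adjoint (act_by gvm_mod c);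
  act_on_ra : forall m : gvm_mod, right_adjoint (act_on m)
}.

Section GVModule.
Variables (C : gv_category) (M : gv_module C).

Definition bact (c : C) (m : M) : M := act_by_ra M (gvG c) m.
Local Notation "c ▶ m" := (bact c m) : cat_scope.

Definition iHom (m n : M) : C := act_on_ra m n.
Definition iHom_curry (c : C) (m n : M) (f : hom (c ▷ m) n) : hom c (iHom m n) :=
  adj (act_on_ra m) (f : hom (act_on m c) n).
Definition iHom_uncurry (c : C) (m n : M) (f : hom c (iHom m n)) : hom (c ▷ m) n :=
  unadj (act_on_ra m) f.
Definition iHom_ev (m n : M) : hom (iHom m n ▷ m) n := ra_counit (act_on_ra m) n.
Definition iHom_functor (m : M) : functor M C := ra_functor (act_on_ra m).
Definition iHom_map (m n n' : M) (f : hom n n') : hom (iHom m n) (iHom m n') :=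
  fmap (iHom_functor m) f.

Definition iHom_comp (m n l : M) : hom (iHom n l ⊗ iHom m n) (iHom m l) :=
  iHom_curry (iHom_ev n l ∘ (idm (iHom n l) ▷₁ iHom_ev m n)
                ∘ act_assoc (iHom n l) (iHom m n) m).
Definition iHom_unit (m : M) : hom one (iHom m m) := iHom_curry (act_unit m).

Definition icoHom (m n : M) : C := gvGi (iHom n m).

(* Hom (n, c ▶ m) = Hom (Gc ▷ n, m) = Hom (Gc, iHom n m)
   = Hom (G^-1 (iHom n m), c) *)
Definition icoHom_adj (c : C) (m n : M) (f : hom n (c ▶ m)) : hom (icoHom m n) c :=
  gvGiG c ∘ gvGim (iHom_curry (unadj (act_by_ra M (gvG c)) f)).
Definition icoHom_unadj (c : C) (m n : M) (f : hom (icoHom m n) c) : hom n (c ▶ m) :=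
  adj (act_by_ra M (gvG c))
    (iHom_uncurry (gvGGi (iHom n m) ∘ gvGm f) : hom (act_by M (gvG c) n) m).

Lemma icoHom_adjK (c : C) (m n : M) (f : hom n (c ▶ m)) :
  icoHom_unadj (icoHom_adj f) = f.
Proof.
rewrite /icoHom_unadj /icoHom_adj gvGmM compmA -gvGGi_nat -compmA gvG_triangle'.
by rewrite compm1 /iHom_uncurry /iHom_curry adjK unadjK.
Qed.

Lemma icoHom_unadjK (c : C) (m n : M) (f : hom (icoHom m n) c) :
  icoHom_adj (icoHom_unadj f) = f.
Proof.
rewrite /icoHom_unadj /icoHom_adj adjK /iHom_uncurry /iHom_curry unadjK.
by rewrite gvGimM compmA gvGiG_nat -compmA gvGi_triangle' compm1.
Qed.

Definition iHom_lax (m : M) (c : C) (n : M) : hom (c ⊗ iHom m n) (iHom m (c ▷ n)) :=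
  iHom_curry ((idm c ▷₁ iHom_ev m n) ∘ act_assoc c (iHom m n) m).

(* Membership of m in the full subcategory on which iHom m - is a strong module
   functor with a right adjoint; the right adjoint is chosen here. *)
Record in_Mhat (m : M) := InMhat {
  Mhat_strong : forall c n, is_iso (iHom_lax m c n);
  Mhat_ra : right_adjoint (iHom_functor m)
}.

Section Serre.
Variables (m : M) (hm : in_Mhat m).

Local Notation Yra := (Mhat_ra hm).

Definition serre : M := Yra gvK.

(* The mate of iHom_lax under the adjunctions Gc ▷ - -| c ▶ -,
   Gc ⊗ - -| c ⊙ - and iHom m - -| Yra; it is invertible because iHom_lax is,
   its inverse being the strong module structure of Yra. *)
Definition Yra_act (c x : C) : hom (c ▶ (Yra x : M)) (Yra (c ⊙ x)) :=
  adj Yra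
    (odot_adj (ra_counit Yra x
                 ∘ iHom_map m (ra_counit (act_by_ra M (gvG c)) (Yra x))
                 ∘ iHom_lax m (gvG c) (c ▶ (Yra x : M)))
       : hom (iHom_functor m _) _).

(* Hom (n, c ▶ S m) = Hom (n, Yra c) = Hom (iHom m n, c), using c ⊙ K = c *)
Definition serre_unadj (c : C) (n : M) (f : hom n (c ▶ serre)) : hom (iHom m n) c :=
  unadj Yra (ra_map Yra (odot_runit c) ∘ Yra_act c gvK ∘ f).

(* The Yoneda image of the isomorphisms
   Hom (icoHom (S m) n, c) = Hom (n, c ▶ S m) = Hom (iHom m n, c). *)
Definition serre_phi (n : M) : hom (iHom m n) (icoHom serre n) :=
  serre_unadj (icoHom_unadj (idm (icoHom serre n))).

Definition serre_tphi (n : M) : hom (iHom n serre) (gvG (iHom m n)) :=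
  gvGm (serre_phi n) ∘ gvGGi_inv (iHom n serre).

Definition serre_trace : hom (iHom m serre) gvK :=
  G1_to_K ∘ gvGm (iHom_unit m) ∘ serre_tphi m.
End Serre.
End GVModule.
Notation "c ▶ m" := (bact c m) : cat_scope.

(* Main.v *)
From mathcomp Require Import ssreflect ssrfun ssrbool.
Require Import Defs.

Set Implicit Arguments.
Unset Strict Implicit.
Unset Printing Implicit Defensive.

Local Open Scope cat_scope.

(** Write A for the internal endomorphism algebra of m, with product mu, and
    S for the Serre object of m. Three observations make the statement true.

    First, the Frobenius map of a form [lam] on an algebra is the pairing
    [lam ∘ mu : A ⊗ A → K] curried to [A → G A] (lemma [frobenius_mapE]), so that
    being a Frobenius form means that this pairing is nondegenerate. The detour
    in the definition through [coevr] and [distr_l] collapses because everything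
    about [⊙] can be read off from the evaluations [G x ⊗ (x ⊙ y) → y]: a map into
    [x ⊙ y] is determined by its composite with the evaluation, and each
    structure map of [⊙] (functoriality, associator, unitors, distributors) has a
    simple description there (section Pairing).

    Second, a nondegenerate [lam ∘ mu] with inverse [psi : G A → A] produces the
    coproduct: [Delta] is the transpose of [mu ∘ (psi ⊗ id) : G A ⊗ A → A]. Tested
    against evaluations, coassociativity and both Frobenius relations become
    associativity of [mu]; the counit laws become the left unit law and the
    definition of [psi] (section FrobeniusAlgebra).

    Third, unfolding the chain of adjunctions that defines the trace shows that
    it is nothing but the counit at K of the adjunction between the functor of
    internal homs out of m and its right adjoint ([serre_traceE]). The pairing
    of [iHom n S] with [iHom m n] by composition followed by the trace is
    therefore nondegenerate by Yoneda: maps [x → iHom n S] are maps [x ▷ n → S],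
    hence maps [iHom m (x ▷ n) → K] by that adjunction, hence maps
    [x ⊗ iHom m n → K] because the internal hom out of m is a strong module
    functor ([trace_comp_nondegenerate]). For n = m, precomposing with the
    isomorphism induced by [p : m → S] gives the pairing [lam ∘ mu] on A.

    Many lemmas below carry extra maps [h], [k] precomposed in each tensor
    factor: an identity between maps out of a tensor product is then applicable
    wherever its left-hand side occurs, without first splitting off whiskered
    factors. *)

(** * Coherence of units *)

Section Isomorphisms.
Variable C : category.

Lemma iso_epi (x y z : C) (i : iso x y) (f g : hom y z) :
  f ∘ i = g ∘ i -> f = g.
Proof.
by move=> e; rewrite -[f]compm1 -[g]compm1 -(iso_inv i) !compmA e.
Qed.

Lemma is_iso_comp (x y z : C) (g : hom y z) (f : hom x y) :
  is_iso g -> is_iso f -> is_iso (g ∘ f).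
Proof.
move=> [g' [g'g gg']] [f' [f'f ff']]; exists (f' ∘ g'); split.
  by rewrite compmA -(compmA f') g'g compm1.
by rewrite compmA -(compmA g) ff' compm1.
Qed.
End Isomorphisms.

Section Coherence.
Variable C : monoidal.

Lemma tensm_fuse (x y x' y' x'' y'' z : C) (h : hom (x'' ⊗ y'') z)
    (f' : hom x' x'') (g' : hom y' y'') (f : hom x x') (g : hom y y') :
  h ∘ (f' ⊗₁ g') ∘ (f ⊗₁ g) = h ∘ ((f' ∘ f) ⊗₁ (g' ∘ g)).
Proof. by rewrite tensmM compmA. Qed.

Section Module.
Variable M : module_category C.

Lemma actm_fuse (x x' x'' : C) (n n' n'' l : M) (h : hom (x'' ▷ n'') l)
    (f' : hom x' x'') (g' : hom n' n'') (f : hom x x') (g : hom n n') :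
  h ∘ (f' ▷₁ g') ∘ (f ▷₁ g) = h ∘ ((f' ∘ f) ▷₁ (g' ∘ g)).
Proof. by rewrite actmM compmA. Qed.

Lemma act_unit_faithful (n l : M) (f g : hom n l) :
  idm one ▷₁ f = idm one ▷₁ g -> f = g.
Proof.
by move=> e; apply: (iso_epi (i := act_unit n)); rewrite -!act_unit_nat e.
Qed.

(** The module version of Kelly's argument: after acting with the unit object,
    which is faithful, the identity follows from the pentagon and the triangle. *)
Lemma act_unit_act (c : C) (n : M) :
  act_unit (c ▷ n) ∘ act_assoc one c n = lunit c ▷₁ idm n.
Proof.
apply: act_unit_faithful; rewrite act_by_mapM.
apply: (iso_epi (i := act_assoc one (one ⊗ c) n)).
have epi (l : M) (f g : hom ((one ⊗ (one ⊗ c)) ▷ n) l) :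
    f ∘ (assoc one one c ▷₁ idm n) = g ∘ (assoc one one c ▷₁ idm n) -> f = g.
  move=> e; rewrite -[f]compm1 -[g]compm1 -actm1 -(iso_inv (assoc one one c)).
  by rewrite act_on_mapM !compmA e.
apply: epi; rewrite -!compmA (compmA (_ ▷₁ act_assoc _ _ _)) -act_pentagon.
rewrite compmA act_triangle -(actm1 c n) -act_assoc_nat -triangle.
by rewrite act_on_mapM compmA act_assoc_nat compmA.
Qed.
End Module.

(** The monoidal category acting on itself: it makes the unit coherence of [⊗]
    an instance of the one for module categories. *)
Definition regular_module : module_category C :=
  @ModuleCategory C C (@tens C) (fun x x' y y' f g => f ⊗₁ g) (@tensm1 C)
    (fun x x' x'' y y' y'' f' g' f g => tensmM f' g' f g)
    assoc (@assoc_nat C) lunit (@lunit_nat C) (@pentagon C) (@triangle C).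

Lemma lunit_tens (x y : C) :
  lunit (x ⊗ y) ∘ assoc one x y = lunit x ⊗₁ idm y.
Proof. exact: (act_unit_act (M := regular_module)). Qed.
End Coherence.

(** * The second tensor product tested by evaluations *)

Section Pairing.
Variable C : gv_category.

Lemma gv_uncurryE (x y : C) (f : hom x (gvG y)) :
  gv_uncurry f = gv_pairing y ∘ (f ⊗₁ idm y).
Proof. exact: pd_unadjE. Qed.

Lemma gv_curryK (x y : C) (f : hom (x ⊗ y) gvK) :
  gv_pairing y ∘ (gv_curry f ⊗₁ idm y) = f.
Proof. by rewrite -gv_uncurryE; exact: pd_adjK. Qed.

Lemma gv_pairing_inj (x y : C) (f g : hom x (gvG y)) :
  gv_pairing y ∘ (f ⊗₁ idm y) = gv_pairing y ∘ (g ⊗₁ idm y) -> f = g.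
Proof.
rewrite -!gv_uncurryE => e.
by rewrite -[f](pd_unadjK (p := gv_dual C)) -[g](pd_unadjK (p := gv_dual C)); congr pd_adj.
Qed.

Lemma gv_pairing_injr (x y : C) (f g : hom x y) :
  gv_pairing y ∘ (idm _ ⊗₁ f) = gv_pairing y ∘ (idm _ ⊗₁ g) -> f = g.
Proof.
move=> /(congr1 (@gv_cocurry C _ _)); rewrite !gv_cocurry_nat gv_cocurry_pairing => e.
by rewrite -[f]comp1m -[g]comp1m -gvGiG_invK -!compmA e.
Qed.

Lemma gv_pairing_nat (x y : C) (f : hom x y) :
  gv_pairing x ∘ (gvGm f ⊗₁ idm x) = gv_pairing y ∘ (idm _ ⊗₁ f).
Proof. exact: pd_pairing_nat. Qed.

(** Dinaturality of the pairing [G y ⊗ y → K]: a map moves from the right-hand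
    factor to its dual on the left. *)
Lemma gv_pairing_slide (w x y z : C) (f : hom x y) (h : hom w (gvG y)) (k : hom z x) :
  gv_pairing y ∘ (h ⊗₁ (f ∘ k)) = gv_pairing x ∘ ((gvGm f ∘ h) ⊗₁ k).
Proof.
rewrite -[h in LHS]comp1m -[k in RHS]comp1m !tensmM !compmA.
by rewrite gv_pairing_nat.
Qed.

Lemma gv_councurryE (x y : C) (f : hom y (gvGi x)) :
  gv_councurry f = gv_pairing (gvGi x) ∘ (gvGGi_inv x ⊗₁ f).
Proof. by rewrite /gv_councurry gv_uncurryE -gv_pairing_slide compm1. Qed.

(** The counit [ev], sealed: it unfolds to a composite, which rewriting with
    associativity would otherwise take apart. *)
Definition evl : forall c y : C, hom (gvG c ⊗ (c ⊙ y)) y := locked (@ev C).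

Lemma ev_adj (c x y : C) (f : hom (gvG c ⊗ x) y) :
  evl c y ∘ (idm _ ⊗₁ odot_adj f) = f.
Proof.
rewrite /evl -lock -[RHS](odot_adjK f); symmetry; exact: (unadjE (R := odot_ra c)).
Qed.

Lemma ev_adj_slide (c x y v w : C) (f : hom (gvG c ⊗ x) y) (h : hom v (gvG c))
    (k : hom w x) :
  evl c y ∘ (h ⊗₁ (odot_adj f ∘ k)) = f ∘ (h ⊗₁ k).
Proof. by rewrite -[h in LHS]comp1m tensmM compmA ev_adj. Qed.

Lemma ev_unadj (c x y : C) (f : hom x (c ⊙ y)) :
  evl c y ∘ (idm _ ⊗₁ f) = odot_unadj f.
Proof. by rewrite /evl -lock; symmetry; exact: (unadjE (R := odot_ra c)). Qed.

Lemma ev_inj (c x y : C) (f g : hom x (c ⊙ y)) :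
  evl c y ∘ (idm _ ⊗₁ f) = evl c y ∘ (idm _ ⊗₁ g) -> f = g.
Proof. by rewrite !ev_unadj => e; rewrite -[f]odot_unadjK -[g]odot_unadjK e. Qed.

(** Since [x ⊙ y] is [G^-1 (G y ⊗ G x)], its pairing with its own dual is the
    evaluation followed by the pairing of y. This determines the evaluation, and
    all later facts about [⊙] are deduced from it. *)
Lemma gv_pairing_odot (c y w1 w2 x : C) (h1 : hom w1 (gvG y)) (h2 : hom w2 (gvG c))
    (k : hom x (c ⊙ y)) :
  gv_pairing (c ⊙ y) ∘ ((gvGGi_inv _ ∘ (h1 ⊗₁ h2)) ⊗₁ k) =
  gv_pairing y ∘ (h1 ⊗₁ (evl c y ∘ (h2 ⊗₁ k))) ∘ assoc w1 w2 x.
Proof.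
have base : gv_pairing (c ⊙ y) ∘ (gvGGi_inv _ ⊗₁ idm _) =
    gv_pairing y ∘ (idm _ ⊗₁ evl c y) ∘ assoc _ _ _.
  rewrite -gv_councurryE -[idm (c ⊙ y)]odot_unadjK -ev_unadj tensm1 compm1.
  exact: gv_cocurryK.
rewrite -[k in LHS]comp1m tensmM compmA base -compmA assoc_nat compmA.
by rewrite tensm_fuse comp1m.
Qed.

Lemma gv_pairing_curryE (w x y z : C) (f : hom (x ⊗ y) gvK) (h : hom w x) (k : hom z y) :
  gv_pairing y ∘ ((gv_curry f ∘ h) ⊗₁ k) = f ∘ (h ⊗₁ k).
Proof. by rewrite -[k in LHS]comp1m tensmM compmA gv_curryK. Qed.

Lemma ev_slide (x x' y y' w z : C) (f : hom x x') (g : hom y y')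
    (h : hom w (gvG x')) (k : hom z (x ⊙ y)) :
  evl x' y' ∘ (h ⊗₁ ((f ⊙₁ g) ∘ k)) = g ∘ evl x y ∘ ((gvGm f ∘ h) ⊗₁ k).
Proof.
apply: gv_pairing_injr; apply: (iso_epi (i := assoc _ _ _)).
rewrite -gv_pairing_odot (gv_pairing_slide (f ⊙₁ g)) /odotm (compmA (gvGm _)) -gvGGi_inv_nat.
by rewrite -(compmA (gvGGi_inv _)) -tensmM gv_pairing_odot -(compmA g) (gv_pairing_slide g).
Qed.

(** Evaluating twice through the associator of [⊙] is evaluating once against
    the dual of [x ⊙ y]. By [gv_pairing_odot] this is the pentagon of [⊗]. *)
Lemma ev_assoc_odot (x y z w1 w2 w3 : C) (h1 : hom w1 (gvG y)) (h2 : hom w2 (gvG x))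
    (k : hom w3 ((x ⊙ y) ⊙ z)) :
  evl y z ∘ (h1 ⊗₁ (evl x (y ⊙ z) ∘ (h2 ⊗₁ (odot_assoc x y z ∘ k)))) ∘ assoc w1 w2 w3 =
  evl (x ⊙ y) z ∘ ((gvGGi_inv _ ∘ (h1 ⊗₁ h2)) ⊗₁ k).
Proof.
have epi t (f g : hom (gvG z ⊗ ((w1 ⊗ w2) ⊗ w3)) t) :
    f ∘ assoc _ _ _ ∘ (assoc _ _ _ ⊗₁ idm _) = g ∘ assoc _ _ _ ∘ (assoc _ _ _ ⊗₁ idm _)
    -> f = g.
  move=> e; apply: (iso_epi (i := assoc _ _ _)).
  rewrite -[LHS]compm1 -[RHS]compm1 -tensm1 -(iso_inv (assoc (gvG z) w1 w2)).
  by rewrite -[idm w3]comp1m tensmM !compmA e.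
(* two different bracketings of four factors: the pentagon identifies them *)
apply: gv_pairing_injr; apply: epi.
rewrite tens_by_mapM -!compmA (compmA (_ ⊗₁ assoc _ _ _)) -pentagon !compmA.
rewrite -!gv_pairing_odot (gv_pairing_slide (odot_assoc x y z)) /odot_assoc (compmA (gvGm _)).
rewrite -gvGGi_inv_nat.
rewrite -!compmA -tensmM comp1m (compmA (gvGGi _)) gvGGi_invK comp1m assoc_nat.
by rewrite (compmA (_ ⊗₁ gvGGi_inv _)) -tensmM comp1m -tensmM compm1 -!compmA.
Qed.

(** The shape in which the unitors of [⊙] meet the pairing. *)
Lemma gvG_counit (x w : C) (q : hom (gvG x) w) :
  gvGm (gvGiG x ∘ gvGim q) = gvGGi_inv w ∘ q.
Proof.
have GiG : gvGm (gvGiG x) = gvGGi_inv (gvG x).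
  by rewrite -[LHS]comp1m -gvGGiK -compmA gvG_triangle' compm1.
by rewrite gvGmM GiG gvGGi_inv_nat.
Qed.

Lemma odot_lunitE (x z : C) (k : hom z (gvK ⊙ x)) :
  odot_lunit x ∘ k ∘ lunit z = evl gvK x ∘ (one_to_GK ⊗₁ k).
Proof.
apply: gv_pairing_injr; apply: (iso_epi (i := assoc _ _ _)).
rewrite -(compmA (odot_lunit x)) gv_pairing_slide /odot_lunit gvG_counit compm1.
rewrite (compmA (gvGGi_inv _)) tensmM (compmA (gv_pairing _)) gv_pairing_odot -!compmA.
congr (_ ∘ (_ ∘ _)); rewrite -(tensm_lr (inv _)) -compmA triangle -tensmM inv_iso.
by rewrite comp1m tensm1 compm1.
Qed.

Lemma gv_pairing_odot_runit (x w z : C) (h : hom w (gvG x)) (k : hom z (x ⊙ gvK)) :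
  gv_pairing x ∘ (h ⊗₁ (odot_runit x ∘ k)) = evl x gvK ∘ (h ⊗₁ k).
Proof.
rewrite gv_pairing_slide /odot_runit gvG_counit -(compmA (gvGGi_inv _)).
have -> : (one_to_GK ⊗₁ idm (gvG x)) ∘ inv (lunit (gvG x)) ∘ h =
    (one_to_GK ⊗₁ h) ∘ inv (lunit w).
  apply: (iso_epi (i := lunit _)); rewrite -!compmA inv_iso compm1 -lunit_nat.
  by rewrite (compmA (inv _)) inv_iso comp1m tensm_lr.
rewrite -[k in LHS]compm1 compmA tensmM compmA gv_pairing_odot.
rewrite /one_to_GK -[gv_curry _]compm1 gv_pairing_curryE lunit_nat.
by rewrite -(compmA _ (lunit _)) lunit_tens -compmA -tensmM iso_inv comp1m tensm1 compm1.
Qed.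

Lemma evl_coev (c x : C) : evl c _ ∘ (idm _ ⊗₁ coev c x) = idm _.
Proof. exact: ev_adj. Qed.

Lemma ev_distr_r (x y z w1 w2 w3 : C) (h : hom w1 (gvG x)) (k : hom w2 (x ⊙ y))
    (l : hom w3 z) :
  evl x (y ⊗ z) ∘ (h ⊗₁ (distr_r x y z ∘ (k ⊗₁ l))) ∘ assoc w1 w2 w3 =
  (evl x y ∘ (h ⊗₁ k)) ⊗₁ l.
Proof.
rewrite -[h in LHS]comp1m tensmM compmA ev_adj -compmA -assoc_nat.
have -> : ev x y = evl x y by rewrite /evl -lock.
rewrite compmA -(compmA (_ ⊗₁ _)) inv_iso compm1 -tensmM.
by rewrite comp1m.
Qed.

(** The unfolded definition, with the adjunction for [G^-1 x ⊙ -] expressed by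
    its evaluation. *)
Lemma distr_lE (x y z w1 w2 : C) (h : hom w1 x) (k : hom w2 (y ⊙ z)) :
  distr_l x y z ∘ (h ⊗₁ k) =
  evl (gvGi x) _ ∘ ((gvGGi_inv x ∘ h) ⊗₁ (odot_assoc (gvGi x) (x ⊗ y) z
     ∘ ((((idm (gvGi x) ⊙₁ (gvGGi x ⊗₁ idm y)) ∘ coev (gvGi x) y) ⊙₁ idm z) ∘ k))).
Proof.
rewrite /distr_l; have -> c u v (f : hom u (c ⊙ v)) :
    unadj (odot_ra c) f = evl c v ∘ (idm _ ⊗₁ f) by rewrite ev_unadj.
by rewrite -!compmA -!tensmM !comp1m -!compmA.
Qed.

(** Under evaluation [distr_l] becomes the canonical map [G (x ⊗ y) ⊗ x → G y],
    which is the pairing of [x ⊗ y] curried in y: the coevaluation in the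
    definition cancels against the evaluation at [G^-1 x]. *)
Lemma ev_distr_l (x y z w1 w2 w3 : C) (h1 : hom w1 (gvG (x ⊗ y))) (h2 : hom w2 x)
    (k : hom w3 (y ⊙ z)) :
  evl (x ⊗ y) z ∘ (h1 ⊗₁ (distr_l x y z ∘ (h2 ⊗₁ k))) ∘ assoc w1 w2 w3 =
  evl y z ∘ (gv_curry (gv_pairing (x ⊗ y) ∘ (h1 ⊗₁ (h2 ⊗₁ idm y)) ∘ assoc w1 w2 y) ⊗₁ k).
Proof.
rewrite distr_lE ev_assoc_odot ev_slide comp1m; congr (_ ∘ (_ ⊗₁ _)).
apply: gv_pairing_inj; rewrite gv_curryK -gv_pairing_slide compm1.
rewrite gv_pairing_odot ev_slide gvGm1 comp1m.
rewrite -[gvGGi_inv x ∘ h2]comp1m -[coev _ _]compm1 tensmM (compmA (_ ∘ evl _ _)).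
rewrite -(compmA (_ ⊗₁ _) (evl _ _)) evl_coev compm1 -tensmM comp1m compmA.
by rewrite gvGGi_invK comp1m.
Qed.

(** A form [b] on [x ⊗ y] contracts x with [y ⊙ z] leaving z; this is evaluation
    against the curried form [x → G y]. *)
Lemma odot_lunit_distr_l (x y z w1 w2 : C) (b : hom (x ⊗ y) gvK)
    (h : hom w1 x) (k : hom w2 (y ⊙ z)) :
  odot_lunit z ∘ (b ⊙₁ idm z) ∘ distr_l x y z ∘ (h ⊗₁ k) =
  evl y z ∘ ((gv_curry b ∘ h) ⊗₁ k).
Proof.
apply: (iso_epi (i := lunit _)).
rewrite -2!(compmA (odot_lunit z)) odot_lunitE -(compmA (b ⊙₁ _)) ev_slide comp1m.
apply: (iso_epi (i := assoc _ _ _)); rewrite ev_distr_l.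
rewrite -gv_pairing_slide /one_to_GK -[gv_curry (lunit _)]compm1 gv_pairing_curryE.
rewrite lunit_nat -!compmA !lunit_tens -!tensmM comp1m compm1.
congr (_ ∘ (_ ⊗₁ _)); apply: gv_pairing_inj.
by rewrite gv_curryK -(compmA (gv_curry b)) gv_pairing_curryE.
Qed.

(** By [odot_lunit_distr_l] the map evaluates the curried form against [coevr],
    which gives back the curried form. *)
Lemma frobenius_mapE (A : C) (mu : hom (A ⊗ A) A) (lam : hom A gvK) :
  frobenius_map mu lam = gv_curry (lam ∘ mu).
Proof.
rewrite /frobenius_map odot_lunit_distr_l compm1 -tensm_rl compmA /coevr ev_slide.
rewrite gvGm1 comp1m -(compmA (runit _)) evl_coev compm1 runit_nat.
by rewrite -compmA iso_inv compm1.
Qed.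
End Pairing.

(** * From a nondegenerate form to a coproduct *)

Section FrobeniusAlgebra.
Variables (C : gv_category) (A : C) (mu : hom (A ⊗ A) A) (eta : hom one A).
Variables (lam : hom A gvK) (psi : hom (gvG A) A).
Hypothesis algA : is_algebra mu eta.
Hypothesis psiK : gv_curry (lam ∘ mu) ∘ psi = idm _.
Hypothesis psi_curry : psi ∘ gv_curry (lam ∘ mu) = idm _.

(** The coproduct for which contracting the left output with a functional [a]
    on A multiplies by the element [psi a] on the left. *)
Definition frobenius_comult : hom A (A ⊙ A) := odot_adj (mu ∘ (psi ⊗₁ idm A)).
Local Notation Delta := frobenius_comult.

Lemma mult_assoc (x y z : C) (h : hom x A) (k : hom y A) (l : hom z A) :
  mu ∘ ((mu ∘ (h ⊗₁ k)) ⊗₁ l) = mu ∘ (h ⊗₁ (mu ∘ (k ⊗₁ l))) ∘ assoc x y z.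
Proof.
have [muA _ _] := algA.
rewrite -[l in LHS]comp1m tensmM compmA muA -compmA assoc_nat !compmA.
by rewrite tensm_fuse comp1m.
Qed.

Lemma ev_comult (x y : C) (h : hom x (gvG A)) (k : hom y A) :
  evl A A ∘ (h ⊗₁ (Delta ∘ k)) = mu ∘ ((psi ∘ h) ⊗₁ k).
Proof.
rewrite -[h in LHS]comp1m tensmM compmA ev_adj.
by rewrite tensm_fuse comp1m.
Qed.

Lemma pairing_form (x y : C) (h : hom x (gvG A)) (k : hom y A) :
  gv_pairing A ∘ (h ⊗₁ k) = lam ∘ mu ∘ ((psi ∘ h) ⊗₁ k).
Proof. by rewrite -(gv_pairing_curryE (lam ∘ mu)) compmA psiK comp1m. Qed.

Lemma form_cancelr (x : C) (f g : hom x A) :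
  lam ∘ mu ∘ (f ⊗₁ idm A) = lam ∘ mu ∘ (g ⊗₁ idm A) -> f = g.
Proof.
rewrite -!(gv_pairing_curryE (lam ∘ mu)) => /gv_pairing_inj e.
by rewrite -[f]comp1m -[g]comp1m -psi_curry -!compmA e.
Qed.

(** The product on [G A] dual to the coproduct is the product of A transported
    along [psi]. *)
Lemma psi_comult (x y : C) (h : hom x (gvG A)) (k : hom y (gvG A)) :
  psi ∘ (gvGm Delta ∘ (gvGGi_inv _ ∘ (h ⊗₁ k))) = mu ∘ ((psi ∘ h) ⊗₁ (psi ∘ k)).
Proof.
apply: form_cancelr; rewrite -pairing_form -gv_pairing_slide compm1 gv_pairing_odot.
rewrite -[Delta]compm1 ev_comult pairing_form -!compmA mult_assoc.
by rewrite !compmA.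
Qed.

Lemma frobenius_coalgebra : is_coalgebra Delta lam.
Proof.
have [_ mul1 _] := algA; split.
- apply: ev_inj; apply: ev_inj; apply: (iso_epi (i := assoc _ _ _)).
  (* both sides are the product of the three factors [psi a], [psi b] and c *)
  rewrite -(compmA (odot_assoc _ _ _)) ev_assoc_odot !ev_slide !comp1m.
  rewrite -{2}[Delta]compm1 ev_comult psi_comult.
  by rewrite gvGm1 comp1m -(compmA Delta) -{2}[Delta]compm1 !ev_comult mult_assoc.
- apply: (iso_epi (i := lunit _)).
  rewrite -(compmA (odot_lunit A)) odot_lunitE ev_slide comp1m -[Delta]compm1 ev_comult.
  (* the functional [lam] itself corresponds to the unit of A under [psi] *)
  rewrite comp1m -mul1; congr (_ ∘ (_ ⊗₁ _)).
  apply: form_cancelr; rewrite -pairing_form -gv_pairing_slide.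
  rewrite /one_to_GK -[gv_curry (lunit _)]compm1 gv_pairing_curryE compm1 lunit_nat.
  by rewrite -mul1 compmA.
- apply: gv_pairing_injr.
  rewrite -compmA gv_pairing_odot_runit ev_slide gvGm1 comp1m.
  by rewrite -[Delta]compm1 -compmA ev_comult pairing_form compmA.
Qed.

Lemma frobenius_comult_algebra : is_gv_frobenius_algebra mu eta Delta lam.
Proof.
split=> //; first exact: frobenius_coalgebra.
- apply: ev_inj; apply: (iso_epi (i := assoc _ _ _)).
  rewrite ev_comult -(compmA (mu ⊙₁ _)) ev_slide comp1m ev_distr_l.
  rewrite -{1}[Delta]compm1 ev_comult.
  (* both sides are products of three factors, once the action of A on [G A]
     coming from [ev_distr_l] is recognised as right multiplication via [psi] *)
  rewrite -{4}[mu]compm1 -(tensm1 A A) -mult_assoc; congr (_ ∘ (_ ⊗₁ _)).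
  apply: form_cancelr; rewrite -pairing_form gv_curryK -gv_pairing_slide pairing_form.
  by rewrite -!compmA mult_assoc -!compmA.
- apply: ev_inj; apply: (iso_epi (i := assoc _ _ _)).
  rewrite ev_comult -(compmA (_ ⊙₁ mu)) ev_slide gvGm1 comp1m -3!(compmA mu).
  by rewrite ev_distr_r -[Delta]compm1 ev_comult mult_assoc tensm1 (compm1 mu) !compmA.
Qed.
End FrobeniusAlgebra.

(** * Internal homs *)

Section InternalHom.
Variables (C : gv_category) (M : gv_module C).

Lemma iHom_uncurryE (c : C) (m n : M) (f : hom c (iHom m n)) :
  iHom_uncurry f = iHom_ev m n ∘ (f ▷₁ idm m).
Proof. exact: (unadjE (R := act_on_ra m)). Qed.

Lemma iHom_ev_curry (c : C) (m n : M) (f : hom (c ▷ m) n) :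
  iHom_ev m n ∘ (iHom_curry f ▷₁ idm m) = f.
Proof. by rewrite -iHom_uncurryE; exact: (@adjK _ _ _ (act_on_ra m)). Qed.

Lemma iHom_uncurry_inj (c : C) (m n : M) (f g : hom c (iHom m n)) :
  iHom_uncurry f = iHom_uncurry g -> f = g.
Proof.
move=> e; rewrite -[f](unadjK (r := act_on_ra m)) -[g](unadjK (r := act_on_ra m)).
exact: congr1 e.
Qed.

Lemma iHom_ev_inj (c : C) (m n : M) (f g : hom c (iHom m n)) :
  iHom_ev m n ∘ (f ▷₁ idm m) = iHom_ev m n ∘ (g ▷₁ idm m) -> f = g.
Proof. by rewrite -!iHom_uncurryE; exact: iHom_uncurry_inj. Qed.

Lemma iHom_ev_map (m n n' : M) (f : hom n n') :
  iHom_ev m n' ∘ (iHom_map m f ▷₁ idm m) = f ∘ iHom_ev m n.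
Proof. exact: iHom_ev_curry. Qed.

Lemma iHom_ev_unit (m : M) :
  iHom_ev m m ∘ (iHom_unit m ▷₁ idm m) = act_unit m.
Proof. exact: iHom_ev_curry. Qed.

Lemma iHom_ev_lax (m n : M) (c : C) :
  iHom_ev m (c ▷ n) ∘ (iHom_lax m c n ▷₁ idm m) =
  (idm c ▷₁ iHom_ev m n) ∘ act_assoc c (iHom m n) m.
Proof. exact: iHom_ev_curry. Qed.

Lemma iHom_ev_comp (c d : C) (z m n l : M) (f : hom c (iHom n l))
    (g : hom d (iHom m n)) (h : hom z m) :
  iHom_ev m l ∘ ((iHom_comp m n l ∘ (f ⊗₁ g)) ▷₁ h) =
  iHom_ev n l ∘ (f ▷₁ (iHom_ev m n ∘ (g ▷₁ h))) ∘ act_assoc c d z.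
Proof.
rewrite -[h in LHS]comp1m actmM compmA iHom_ev_curry -compmA act_assoc_nat compmA.
by rewrite actm_fuse comp1m.
Qed.

Lemma iHom_comp_assoc (m n l k : M) :
  iHom_comp m n k ∘ (iHom_comp n l k ⊗₁ idm (iHom m n)) =
  iHom_comp m l k ∘ (idm (iHom l k) ⊗₁ iHom_comp m n l) ∘ assoc _ _ _.
Proof.
apply: iHom_ev_inj; rewrite [in RHS]act_on_mapM compmA !iHom_ev_comp.
rewrite -[iHom_comp n l k]compm1 -[iHom_comp m n l]compm1 -!tensm1 !iHom_ev_comp.
rewrite !actm1 !compm1 act_by_mapM -!compmA act_pentagon.
by rewrite !act_by_mapM -!compmA.
Qed.

Lemma iHom_comp_unitl (m n : M) :
  iHom_comp m n n ∘ (iHom_unit n ⊗₁ idm _) = lunit (iHom m n).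
Proof.
apply: iHom_ev_inj; rewrite iHom_ev_comp actm1 compm1.
rewrite -[iHom_unit n]compm1 -[iHom_ev m n in LHS]comp1m actmM compmA iHom_ev_unit.
by rewrite act_unit_nat -compmA act_unit_act.
Qed.

Lemma iHom_comp_unitr (m n : M) :
  iHom_comp m m n ∘ (idm _ ⊗₁ iHom_unit m) = runit (iHom m n).
Proof.
apply: iHom_ev_inj; rewrite iHom_ev_comp iHom_ev_unit.
by rewrite -compmA act_triangle.
Qed.

Lemma iHom_comp_map (m n l k : M) (f : hom l k) :
  iHom_map m f ∘ iHom_comp m n l = iHom_comp m n k ∘ (iHom_map n f ⊗₁ idm _).
Proof.
apply: iHom_ev_inj; rewrite iHom_ev_comp actm1 compm1 act_on_mapM compmA iHom_ev_map.
rewrite -compmA -[iHom_comp _ _ _]compm1 -tensm1 iHom_ev_comp actm1 compm1.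
by rewrite -[iHom_ev m n in RHS]comp1m -[iHom_map n f]compm1 actmM !compmA iHom_ev_map.
Qed.

(** Composing with the name [f] of a map [c ▷ n → l] is applying that map after
    the module constraint; this links composition, through which the trace pairing
    is defined, with strength, through which it is nondegenerate. *)
Lemma iHom_comp_lax (c : C) (m n l : M) (f : hom c (iHom n l)) :
  iHom_comp m n l ∘ (f ⊗₁ idm _) = iHom_map m (iHom_uncurry f) ∘ iHom_lax m c n.
Proof.
apply: iHom_ev_inj; rewrite iHom_ev_comp actm1 compm1 act_on_mapM compmA iHom_ev_map.
rewrite -(compmA (iHom_uncurry f)) iHom_ev_lax iHom_uncurryE compmA actm_fuse.
by rewrite comp1m compm1.
Qed.

Lemma iHom_lax_nat (c : C) (m n n' : M) (f : hom n n') :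
  iHom_lax m c n' ∘ (idm c ⊗₁ iHom_map m f) = iHom_map m (idm c ▷₁ f) ∘ iHom_lax m c n.
Proof.
apply: iHom_ev_inj; rewrite !act_on_mapM !compmA iHom_ev_lax iHom_ev_map.
rewrite -[in RHS]compmA iHom_ev_lax -compmA act_assoc_nat !compmA -!actmM.
by rewrite iHom_ev_map.
Qed.

Lemma iHom_mapM (m n l k : M) (g : hom l k) (f : hom n l) :
  iHom_map m (g ∘ f) = iHom_map m g ∘ iHom_map m f.
Proof. exact: (fmapM (iHom_functor m)). Qed.

Lemma iHom_map_iso (m n n' : M) (f : hom n n') : is_iso f -> is_iso (iHom_map m f).
Proof.
have map1 x : iHom_map m (idm x) = idm _ by exact: (fmap1 (iHom_functor m)).
by move=> [g [gf fg]]; exists (iHom_map m g); rewrite -!iHom_mapM gf fg !map1.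
Qed.

Lemma iHom_algebra (m : M) : is_algebra (iHom_comp m m m) (iHom_unit m).
Proof.
split; [exact: iHom_comp_assoc | exact: iHom_comp_unitl | exact: iHom_comp_unitr].
Qed.
End InternalHom.

(** * The trace of the relative Serre functor *)

Section Serre.
Variables (C : gv_category) (M : gv_module C) (m : M) (hm : in_Mhat m).
Local Notation S := (serre hm).
Local Notation eps := (ra_counit (Mhat_ra hm) gvK).

Lemma Yra_unadjE (n : M) (x : C) (f : hom n (Mhat_ra hm x)) :
  unadj (Mhat_ra hm) f = ra_counit (Mhat_ra hm) x ∘ iHom_map m f.
Proof. exact: (unadjE (R := Mhat_ra hm)). Qed.

(** The map [c ▶ S → Yra c] built into [serre_unadj] is a mate of the module
    constraint; pairing with [G c] undoes the mate and leaves the constraint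
    itself. *)
Lemma serre_unadjE (c w : C) (n : M) (f : hom n (c ▶ S)) (h : hom w (gvG c)) :
  gv_pairing c ∘ (h ⊗₁ serre_unadj f) =
  eps ∘ iHom_map m (unadj (act_by_ra M (gvG c)) f) ∘ iHom_lax m (gvG c) n ∘ (h ⊗₁ idm _).
Proof.
rewrite /serre_unadj !unadj_nat /ra_map adjK -(compmA (odot_runit c)) -unadjE.
rewrite /Yra_act adjK -(compmA (odot_runit c)) gv_pairing_odot_runit ev_adj_slide.
rewrite -[fmap _ f]/(iHom_map m f) -(tensm_rl h) compmA -(compmA _ (iHom_lax _ _ _)).
have -> : unadj (act_by_ra M (gvG c)) f =
    ra_counit (act_by_ra M (gvG c)) S ∘ (idm _ ▷₁ f) by exact: unadjE.
by rewrite iHom_lax_nat iHom_mapM !compmA.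
Qed.

(** The isomorphism is the Yoneda image of an identity, so [serre_unadjE] applies
    to the evaluation [iHom n S ▷ n → S], and [iHom_comp_lax] turns the result
    into composition followed by the counit [eps]. *)
Lemma serre_tphiE (n : M) :
  serre_tphi hm n = gv_curry (eps ∘ iHom_comp m n S).
Proof.
apply: gv_pairing_inj; rewrite gv_curryK -gv_pairing_slide compm1.
rewrite /serre_phi serre_unadjE /icoHom_unadj adjK gvGm1 compm1.
rewrite -(compmA eps) -iHom_comp_lax -!compmA -tensmM gvGGi_invK comp1m tensm1.
by rewrite compm1.
Qed.

(** The trace evaluates the pairing [eps ∘ iHom_comp] of [serre_tphiE] at the
    unit of [iHom m m], and composing with that unit does nothing. *)
Lemma serre_traceE : serre_trace hm = eps.
Proof.
apply: (iso_epi (i := runit _)); rewrite /serre_trace -2!(compmA G1_to_K) -runit_nat.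
rewrite /G1_to_K -(compmA (gv_pairing _)) (compmA (inv _)) inv_iso comp1m.
rewrite -gv_pairing_slide compm1 serre_tphiE.
by rewrite -[gv_curry _]compm1 gv_pairing_curryE -compmA iHom_comp_unitr.
Qed.

(** Composing with the curried pairing [T] is, up to the invertible module
    constraint, the adjunction bijection from maps [x ▷ n → S] to maps
    [iHom m (x ▷ n) → K]. Hence [T] is monic, and it has a section, namely the
    preimage of the identity. *)
Lemma trace_comp_nondegenerate (n : M) :
  is_iso (gv_curry (serre_trace hm ∘ iHom_comp m n S)).
Proof.
rewrite serre_traceE; set T := gv_curry _.
have TE (x : C) (f : hom x (iHom n S)) : gv_pairing _ ∘ ((T ∘ f) ⊗₁ idm _) =
    unadj (Mhat_ra hm) (iHom_uncurry f) ∘ iHom_lax m x n.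
  by rewrite gv_pairing_curryE -compmA iHom_comp_lax compmA Yra_unadjE.
have T_inj (x : C) (f g : hom x (iHom n S)) : T ∘ f = T ∘ g -> f = g.
  move=> e; apply: iHom_uncurry_inj.
  have [l [_ laxK]] := Mhat_strong hm x n.
  rewrite -[LHS](unadjK (r := Mhat_ra hm)) -[RHS](unadjK (r := Mhat_ra hm)).
  by rewrite -[unadj _ _]compm1 -laxK compmA -TE e TE -compmA laxK compm1.
have [l [lK laxK]] := Mhat_strong hm (gvG (iHom m n)) n.
pose q : hom (gvG (iHom m n) ▷ n) S := adj (Mhat_ra hm) (gv_pairing (iHom m n) ∘ l).
(* [q] is the map [G (iHom m n) ▷ n → S] that corresponds to the identity *)
have Tq : T ∘ iHom_curry q = idm _.
  apply: gv_pairing_inj; rewrite TE /iHom_uncurry /iHom_curry !adjK.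
  by rewrite -compmA lK tensm1.
exists (iHom_curry q); split=> //; apply: T_inj.
by rewrite compmA Tq comp1m compm1.
Qed.
End Serre.

Theorem theorem5p20 (C : gv_category) (M : gv_module C) (m : M)
    (hm : in_Mhat m) (p : hom m (serre hm)) (hp : is_iso p) :
  let mu := iHom_comp m m m in
  let eta := iHom_unit m in
  let lambda := serre_trace hm ∘ iHom_map m p in
  is_frobenius_form mu eta lambda /\
  exists Delta : hom (iHom m m) (iHom m m ⊙ iHom m m),
    is_gv_frobenius_algebra mu eta Delta lambda.
Proof.
move=> mu eta lambda.
have algA : is_algebra mu eta := iHom_algebra m.
have curryE : gv_curry (lambda ∘ mu) =
    gv_curry (serre_trace hm ∘ iHom_comp m m (serre hm)) ∘ iHom_map m p.
  apply: gv_pairing_inj.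
  by rewrite gv_curryK gv_pairing_curryE -!compmA iHom_comp_map.
have curry_iso : is_iso (gv_curry (lambda ∘ mu)).
  rewrite curryE; apply: is_iso_comp; first exact: trace_comp_nondegenerate.
  exact: iHom_map_iso.
split; first by split=> //; rewrite frobenius_mapE.
have [psi [psi_curry psiK]] := curry_iso.
exists (frobenius_comult mu psi).
exact: frobenius_comult_algebra.
Qed.
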